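(* Let $\mathbb{D}=\{z\in\mathbb{C}:|z|<1\}$. Let $f=h+\overline{g}$ be a sense-preserving univalent harmonic mapping defined on $\mathbb{D}$, with $h,g$ holomorphic in $\mathbb{D}$ and dilatation $\omega=g'/h'$, and suppose that $\Omega=f(\mathbb{D})$ is linearly connected with constant $M$. If $|\omega(z)|<1/(1+2M)$ for all $z\in\mathbb{D}$, then $F=h+e^{i\theta}\overline{g}$ is univalent in $\mathbb{D}$ for every $\theta\in\mathbb{R}$.
   Context: Univalent means injective. A planar harmonic mapping is a complex-valued harmonic function on a domain in $\mathbb{C}$; on $\mathbb{D}$ it can be written $f=h+\overline{g}$ with $h,g$ holomorphic. It is locally univalent and sense-preserving (orientation-preserving) if and only if its Jacobian $|h'|^2-|g'|^2$ is positive, i.e. $|g'|<|h'|$ in $\mathbb{D}$, equivalently $h'(z)\neq 0$ and the dilatation $\omega=g'/h'$ satisfies $|\omega(z)|<1$ in $\mathbb{D}$. A domain $\Omega\subset\mathbb{C}$ is linearly connected with constant $M<\infty$ if any two points $w_1,w_2\in\Omega$ are joined by a path $\gamma\subset\Omega$ of length $l(\gamma)\le M|w_1-w_2|$. *)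

(* Defs.v *)
From Stdlib Require Import Reals.
From Coquelicot Require Import Coquelicot.

Open Scope R_scope.

Definition unit_disk (z : C) : Prop := Cmod z < 1.

Definition image (f : C -> C) (D : C -> Prop) (w : C) : Prop :=
  exists z, D z /\ f z = w.

Definition univalent_on (D : C -> Prop) (f : C -> C) : Prop :=
  forall z1 z2, D z1 -> D z2 -> f z1 = f z2 -> z1 = z2.

(* The derivative is taken over the absolute ring [C_AbsRing], i.e. it is the
   complex derivative; [C_derive] below is its value. *)
Definition holomorphic_on (D : C -> Prop) (f : C -> C) : Prop :=
  forall z, D z -> ex_derive (K := C_AbsRing) (V := C_NormedModule) f z.

(* Real Jacobian determinant u_x v_y - u_y v_x of f = u + i v at z = (x, y);
   for f = h + conj g with h, g holomorphic it equals |h'|^2 - |g'|^2. *)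
Definition jacobian (f : C -> C) (z : C) : R :=
  let (x, y) := z in
  Derive (fun t => fst (f (t, y))) x * Derive (fun t => snd (f (x, t))) y
  - Derive (fun t => fst (f (x, t))) y * Derive (fun t => snd (f (t, y))) x.

Definition sense_preserving_on (D : C -> Prop) (f : C -> C) : Prop :=
  forall z, D z -> 0 < jacobian f z.

(* Meaningful where h' does not vanish, as is the case when h + conj g is
   sense-preserving. *)
Definition dilatation (h g : C -> C) (z : C) : C :=
  (C_derive g z / C_derive h z)%C.

Definition unit_interval (t : R) : Prop := 0 <= t <= 1.

(* Endpoint continuity is one-sided: [continuous_on] uses the filter of
   neighbourhoods within the interval. *)
Definition path_in (Omega : C -> Prop) (w1 w2 : C) (gamma : R -> C) : Prop :=
  continuous_on unit_interval gamma /\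
  gamma 0 = w1 /\ gamma 1 = w2 /\
  (forall t, unit_interval t -> Omega (gamma t)).

(* [l] is the length of the polygon inscribed in [gamma] at the nodes
   0 = t 0 <= t 1 <= ... <= t (S n) = 1. *)
Definition inscribed_length (gamma : R -> C) (l : R) : Prop :=
  exists (n : nat) (t : nat -> R),
    t 0%nat = 0 /\ t (S n) = 1 /\
    (forall k : nat, (k <= n)%nat -> t k <= t (S k)) /\
    l = sum_f_R0 (fun k => Cmod (gamma (t (S k)) - gamma (t k))%C) n.

(* Extended-real valued: [p_infty] for non-rectifiable paths. *)
Definition path_length (gamma : R -> C) : Rbar :=
  Lub_Rbar (inscribed_length gamma).

Definition linearly_connected (Omega : C -> Prop) (M : R) : Prop :=
  forall w1 w2, Omega w1 -> Omega w2 ->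
    exists gamma : R -> C,
      path_in Omega w1 w2 gamma /\
      Rbar_le (path_length gamma) (Finite (M * Cmod (w1 - w2)%C)).

Definition cis (theta : R) : C := (cos theta, sin theta).

(* Main.v *)
Require Import Defs.
From Stdlib Require Import Reals Lra Lia Psatz Classical ClassicalEpsilon.
From Coquelicot Require Import Coquelicot.

(** Suppose [F z1 = F z2] with [z1 <> z2], and put [w1 = f z1], [w2 = f z2].
    Since [h z1 - h z2 = - cis theta * Cconj (g z1 - g z2)], we get
    [w1 - w2 = (1 - cis theta) * Cconj (g z1 - g z2)], so that
    [|w1 - w2| <= 2 |g z1 - g z2|].  On the other hand, consider [g] as a
    function of [w = f z]: as [|dw| >= (|h'| - |g'|) |dz|], its local Lipschitz
    constant at [w] is at most [|omega| / (1 - |omega|)], which is less than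
    [1 / (2 M)].  Adding up along a path from [w1] to [w2] of length at most
    [M |w1 - w2|] gives [|g z1 - g z2| < |w1 - w2| / 2], a contradiction.

    Two points of this argument need care; both are settled with derivatives
    at single points.
    - Following the path in the disk requires that the inverse of [f] be
      continuous, i.e. that [f] be open ([wirtinger_open]).  For this the
      distance from [f] to a target value is minimised over a small square: at
      an interior minimum where the value is not attained, invertibility of
      the differential would allow a further decrease ([wirtinger_descent]).
    - The summation along the path ([path_growth]) is a continuous induction
      on the parameter.  It uses finitely many pointwise estimates, each with
      its own constant below [1 / (2 M)]; their maximum is still below
      [1 / (2 M)], which keeps the final inequality strict. *)

Open Scope R_scope.

(** * Real differentiability in complex form *)

(** Real differentiability of [f] at [z], with [a] and [b] the Wirtinger
    derivatives of [f] with respect to [z] and its conjugate.  The differential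
    is invertible and sense-preserving exactly when [Cmod b < Cmod a]. *)
Definition wirtinger (f : C -> C) (z a b : C) : Prop :=
  forall eps, 0 < eps -> exists delta, 0 < delta /\
    forall z', Cmod (z' - z)%C < delta ->
      Cmod (f z' - f z - (a * (z' - z) + b * Cconj (z' - z)))%C
        <= eps * Cmod (z' - z)%C.

Lemma Cmod_sym (a b : C) : Cmod (a - b)%C = Cmod (b - a)%C.
Proof. rewrite <- Cmod_opp. f_equal. ring. Qed.

Lemma Cmod_sum_ge (a b : C) : Cmod a - Cmod b <= Cmod (a + b)%C.
Proof.
  pose proof (Cmod_triangle (a + b) (- b)) as H.
  rewrite Cmod_opp in H.
  replace (a + b + - b)%C with a in H by ring. lra.
Qed.

Lemma Cmod_le_coords (z : C) : Cmod z <= Rabs (fst z) + Rabs (snd z).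
Proof.
  destruct z as [x y]; simpl.
  replace (x, y) with (RtoC x + Ci * RtoC y)%C
    by (apply injective_projections; simpl; ring).
  eapply Rle_trans; [apply Cmod_triangle|].
  rewrite Cmod_mult, Cmod_Ci, !Cmod_R. lra.
Qed.

Lemma fst_le_Cmod (z : C) : Rabs (fst z) <= Cmod z.
Proof. eapply Rle_trans; [apply Rmax_l|apply Rmax_Cmod]. Qed.

Lemma snd_le_Cmod (z : C) : Rabs (snd z) <= Cmod z.
Proof. eapply Rle_trans; [apply Rmax_r|apply Rmax_Cmod]. Qed.

Lemma is_derive_wirtinger (f : C -> C) (z l : C) :
  is_derive (K := C_AbsRing) (V := C_NormedModule) f z l ->
  wirtinger f z l 0.
Proof.
  intros [_ H] eps Heps.
  specialize (H z (fun P HP => HP) (mkposreal eps Heps)).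
  destruct H as [d Hd].
  exists d; split; [apply cond_pos|].
  intros z' Hz'. specialize (Hd z' Hz').
  eapply Rle_trans; [|exact Hd].
  change (norm ?x) with (Cmod x).
  apply Req_le. f_equal.
  unfold minus, scal, plus, opp; simpl. unfold mult; simpl. ring.
Qed.

Lemma wirtinger_add_conj (f h g : C -> C) (z a b : C) (r : R) :
  0 < r ->
  (forall z', Cmod (z' - z)%C < r -> f z' = (h z' + Cconj (g z'))%C) ->
  wirtinger h z a 0 -> wirtinger g z b 0 ->
  wirtinger f z a (Cconj b).
Proof.
  intros Hr Hf Hh Hg eps Heps.
  destruct (Hh (eps / 2)) as [d1 [Hd1 H1]]; [lra|].
  destruct (Hg (eps / 2)) as [d2 [Hd2 H2]]; [lra|].
  exists (Rmin r (Rmin d1 d2)); split.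
  { repeat apply Rmin_pos; assumption. }
  intros z' Hz'.
  pose proof (Rmin_l r (Rmin d1 d2)). pose proof (Rmin_r r (Rmin d1 d2)).
  pose proof (Rmin_l d1 d2). pose proof (Rmin_r d1 d2).
  assert (E1 := H1 z' ltac:(lra)). assert (E2 := H2 z' ltac:(lra)).
  rewrite (Hf z') by lra.
  rewrite (Hf z) by (replace (z - z)%C with (RtoC 0) by ring; rewrite Cmod_0; lra).
  rewrite <- Cmod_conj in E2.
  rewrite Cminus_conj, Cminus_conj, Cplus_conj, !Cmult_conj in E2.
  replace (h z' + Cconj (g z') - (h z + Cconj (g z))
           - (a * (z' - z) + Cconj b * Cconj (z' - z)))%C
    with ((h z' - h z - (a * (z' - z) + 0 * Cconj (z' - z)))
          + (Cconj (g z') - Cconj (g z)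
             - (Cconj b * Cconj (z' - z) + Cconj 0 * Cconj (Cconj (z' - z)))))%C.
  - eapply Rle_trans; [apply Cmod_triangle|]. lra.
  - replace (Cconj 0) with (RtoC 0)
      by (apply injective_projections; simpl; ring).
    ring.
Qed.

(** Common form of the four partial derivatives in [jacobian]: [p] is a line
    through [z] with unit direction [v], and [q] is the real or imaginary
    part. *)
Lemma wirtinger_directional (f : C -> C) (z a b v : C) (p : R -> C) (x : R)
    (q : C -> R) :
  wirtinger f z a b ->
  p x = z ->
  (forall t, (p t - z)%C = (RtoC (t - x) * v)%C) -> Cmod v = 1 ->
  (forall c, Rabs (q c) <= Cmod c) ->
  (forall c d, q (c - d)%C = q c - q d) ->
  (forall t c, q (RtoC t * c)%C = t * q c) ->
  Derive (fun t => q (f (p t))) x = q (a * v + b * Cconj v)%C.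
Proof.
  intros Hw Hpx Hp Hv Hq Hqm Hqs.
  apply is_derive_unique. apply is_derive_Reals.
  intros eps Heps.
  destruct (Hw (eps / 2)) as [d [Hd H]]; [lra|].
  exists (mkposreal d Hd). intros k Hk0 Hk. simpl in Hk.
  assert (Hpk := Hp (x + k)).
  replace (x + k - x) with k in Hpk by ring.
  assert (Hm : Cmod (p (x + k)%R - z)%C = Rabs k).
  { rewrite Hpk, Cmod_mult, Cmod_R, Hv. ring. }
  specialize (H (p (x + k))). rewrite Hm in H. specialize (H Hk).
  apply (Rle_trans _ _ _ (Hq _)) in H.
  rewrite Hpk in H.
  replace (a * (k * v) + b * Cconj (k * v))%C with (k * (a * v + b * Cconj v))%C in H.
  2:{ rewrite Cmult_conj.
      replace (Cconj (RtoC k)) with (RtoC k)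
        by (apply injective_projections; simpl; ring).
      ring. }
  rewrite !Hqm, Hqs in H. rewrite Hpx.
  set (D := q (a * v + b * Cconj v)%C) in *.
  replace ((q (f (p (x + k))) - q (f z)) / k - D)
    with ((q (f (p (x + k))) - q (f z) - k * D) / k) by (field; assumption).
  unfold Rdiv at 1. rewrite Rabs_mult, Rabs_inv.
  pose proof (Rabs_pos_lt k Hk0).
  apply Rmult_lt_reg_r with (Rabs k); [assumption|].
  rewrite Rmult_assoc, Rinv_l by lra. nra.
Qed.

Lemma wirtinger_jacobian (f : C -> C) (z a b : C) :
  wirtinger f z a b -> jacobian f z = Cmod a ^ 2 - Cmod b ^ 2.
Proof.
  intros Hw. destruct z as [x y]. unfold jacobian.
  rewrite (wirtinger_directional f (x, y) a b 1 (fun t => (t, y)) x fst)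
    by (auto using fst_le_Cmod, Cmod_1; intros; try apply injective_projections; simpl; ring).
  rewrite (wirtinger_directional f (x, y) a b 1 (fun t => (t, y)) x snd)
    by (auto using snd_le_Cmod, Cmod_1; intros; try apply injective_projections; simpl; ring).
  rewrite (wirtinger_directional f (x, y) a b Ci (fun t => (x, t)) y fst)
    by (auto using fst_le_Cmod, Cmod_Ci; intros; try apply injective_projections; simpl; ring).
  rewrite (wirtinger_directional f (x, y) a b Ci (fun t => (x, t)) y snd)
    by (auto using snd_le_Cmod, Cmod_Ci; intros; try apply injective_projections; simpl; ring).
  rewrite !Cmod2_alt. unfold Re, Im. simpl. ring.
Qed.

Lemma wirtinger_lipschitz (f : C -> C) (z a b : C) (L : R) :
  wirtinger f z a b -> Cmod a + Cmod b < L ->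
  exists delta, 0 < delta /\ forall z', Cmod (z' - z)%C < delta ->
    Cmod (f z' - f z)%C <= L * Cmod (z' - z)%C.
Proof.
  intros Hw HL.
  destruct (Hw (L - (Cmod a + Cmod b))) as [d [Hd H]]; [lra|].
  exists d; split; [assumption|]. intros z' Hz'.
  specialize (H z' Hz').
  set (D := (a * (z' - z) + b * Cconj (z' - z))%C) in *.
  assert (HD : Cmod D <= (Cmod a + Cmod b) * Cmod (z' - z)%C).
  { unfold D. eapply Rle_trans; [apply Cmod_triangle|].
    rewrite !Cmod_mult, Cmod_conj. lra. }
  replace (f z' - f z)%C with ((f z' - f z - D) + D)%C by ring.
  eapply Rle_trans; [apply Cmod_triangle|]. lra.
Qed.

Lemma wirtinger_expansion (f : C -> C) (z a b : C) (kappa : R) :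
  wirtinger f z a b -> kappa < Cmod a - Cmod b ->
  exists delta, 0 < delta /\ forall z', Cmod (z' - z)%C < delta ->
    kappa * Cmod (z' - z)%C <= Cmod (f z' - f z)%C.
Proof.
  intros Hw HL.
  destruct (Hw (Cmod a - Cmod b - kappa)) as [d [Hd H]]; [lra|].
  exists d; split; [assumption|]. intros z' Hz'.
  specialize (H z' Hz').
  set (D := (a * (z' - z) + b * Cconj (z' - z))%C) in *.
  assert (HD : (Cmod a - Cmod b) * Cmod (z' - z)%C <= Cmod D).
  { unfold D.
    eapply Rle_trans; [|apply Cmod_sum_ge].
    rewrite !Cmod_mult, Cmod_conj. lra. }
  replace (f z' - f z)%C with (D + (f z' - f z - D))%C by ring.
  eapply Rle_trans; [|apply Cmod_sum_ge]. lra.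
Qed.

(** * Openness *)

(** Moving from [p] in the direction that the differential maps to [w - f p]
    brings [f] closer to [w]. *)
Lemma wirtinger_descent (f : C -> C) (p a b w : C) (r : R) :
  wirtinger f p a b -> Cmod b < Cmod a -> f p <> w -> 0 < r ->
  exists q, Cmod (q - p)%C < r /\ Cmod (f q - w)%C < Cmod (f p - w)%C.
Proof.
  intros Hw Hab Hne Hr.
  set (v := (w - f p)%C).
  assert (Hv : 0 < Cmod v).
  { apply Cmod_gt_0. intros E. apply Hne. unfold v in E.
    replace w with (w - f p + f p)%C by ring. rewrite E. ring. }
  set (J := (Cmod a ^ 2 - Cmod b ^ 2)).
  assert (HJ : 0 < J).
  { unfold J. pose proof (Cmod_ge_0 b). nra. }
  assert (HJC : RtoC J <> 0).
  { intros E. apply RtoC_inj in E. lra. }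
  assert (HJE : RtoC J = (a * Cconj a - b * Cconj b)%C).
  { unfold J. rewrite RtoC_minus, !RtoC_pow, <- !Cmod2_conj, !RtoC_pow. reflexivity. }
  assert (HJr : Cconj (RtoC J) = RtoC J).
  { apply injective_projections; simpl; ring. }
  (* Inverse of the differential applied to [v] *)
  set (zeta := ((Cconj a * v - b * Cconj v) / RtoC J)%C).
  assert (Hz : (a * zeta + b * Cconj zeta)%C = v).
  { unfold zeta.
    rewrite Cdiv_conj by assumption.
    rewrite HJr, Cminus_conj, !Cmult_conj, !Cconj_conj.
    transitivity (v * (a * Cconj a - b * Cconj b) / RtoC J)%C.
    - field. assumption.
    - rewrite <- HJE. field. assumption. }
  pose proof (Cmod_ge_0 zeta) as Hz0.
  set (K := Cmod zeta + 1).
  assert (HK : 0 < K) by (unfold K; lra).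
  destruct (Hw (Cmod v / (2 * K))) as [d [Hd H]].
  { apply Rdiv_lt_0_compat; lra. }
  set (m := Rmin d r).
  assert (Hm : 0 < m) by (apply Rmin_pos; assumption).
  set (t := Rmin 1 (m / K)).
  assert (Ht : 0 < t).
  { apply Rmin_pos; [lra|]. apply Rdiv_lt_0_compat; assumption. }
  assert (Ht1 : t <= 1) by apply Rmin_l.
  assert (HtK : t * K <= m).
  { apply Rle_trans with (m / K * K).
    - apply Rmult_le_compat_r; [lra|]. apply Rmin_r.
    - right. field. lra. }
  set (q := (p + RtoC t * zeta)%C).
  assert (Hqp : (q - p)%C = (RtoC t * zeta)%C) by (unfold q; ring).
  assert (Hqm : Cmod (q - p)%C = t * Cmod zeta).
  { rewrite Hqp, Cmod_mult, Cmod_R, Rabs_pos_eq; lra. }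
  assert (Hqlt : Cmod (q - p)%C < m) by (rewrite Hqm; unfold K in HtK; nra).
  exists q. split.
  { eapply Rlt_le_trans; [exact Hqlt|]. apply Rmin_r. }
  specialize (H q). rewrite Hqm in H.
  assert (H' := H ltac:(rewrite <- Hqm; eapply Rlt_le_trans; [exact Hqlt|apply Rmin_l])).
  clear H. rewrite Hqp in H'.
  replace (a * (t * zeta) + b * Cconj (t * zeta))%C with (RtoC t * v)%C in H'.
  2:{ rewrite <- Hz, Cmult_conj.
      replace (Cconj (RtoC t)) with (RtoC t)
        by (apply injective_projections; simpl; ring).
      ring. }
  replace (f q - w)%C with ((f q - f p - t * v) + RtoC (1 - t) * (- v))%C.
  2:{ rewrite RtoC_minus. unfold v. ring. }
  replace (Cmod (f p - w)) with (Cmod v) by (unfold v; apply Cmod_sym).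
  eapply Rle_lt_trans; [apply Cmod_triangle|].
  rewrite Cmod_mult, Cmod_opp, Cmod_R, (Rabs_pos_eq (1 - t)) by lra.
  assert (Cmod v / (2 * K) * (t * Cmod zeta) <= t * Cmod v / 2).
  { replace (t * Cmod v / 2) with (Cmod v / (2 * K) * (t * K)) by (field; lra).
    apply Rmult_le_compat_l.
    - left. apply Rdiv_lt_0_compat; lra.
    - unfold K. nra. }
  nra.
Qed.

Definition in_square (z : C) (r : R) (p : C) : Prop :=
  Rabs (fst p - fst z) <= r /\ Rabs (snd p - snd z) <= r.

(** If the infimum [m] were not attained, each point would have a neighbourhood
    on which the function exceeds [m] by a positive amount, and by compactness
    one amount would serve for the whole square. *)
Lemma square_attains_min (phi : C -> R) (z : C) (r : R) :
  0 < r -> (forall p, 0 <= phi p) ->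
  (forall p, in_square z r p -> forall eps, 0 < eps -> exists delta, 0 < delta /\
     forall q, Cmod (q - p)%C < delta -> phi p - eps < phi q) ->
  exists p, in_square z r p /\ forall q, in_square z r q -> phi p <= phi q.
Proof.
  intros Hr Hpos Hcont.
  assert (Hzz : in_square z r z).
  { split; rewrite Rminus_diag, Rabs_R0; lra. }
  destruct (completeness (fun y => exists p, in_square z r p /\ y = - phi p))
    as [s [Hub Hlub]].
  { exists 0. intros y [p [_ ->]]. specialize (Hpos p). lra. }
  { exists (- phi z), z. split; auto. }
  set (m := - s).
  assert (Hm : forall p, in_square z r p -> m <= phi p).
  { intros p Hp. unfold m.
    assert (- phi p <= s) by (apply Hub; exists p; auto). lra. }
  destruct (classic (exists p, in_square z r p /\ phi p <= m)) as [[p [Hp Hpm]]|Hno].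
  { exists p. split; [assumption|]. intros q Hq. specialize (Hm q Hq). lra. }
  exfalso.
  assert (Hgap : forall x y, exists d : posreal, in_square z r (x, y) ->
    forall q, Rabs (fst q - x) < d -> Rabs (snd q - y) < d -> m + d <= phi q).
  { intros x y.
    destruct (classic (in_square z r (x, y))) as [Hxy|Hxy];
      [|exists (mkposreal 1 Rlt_0_1); tauto].
    assert (Hlt : 0 < (phi (x, y) - m) / 2).
    { assert (~ phi (x, y) <= m) by (intros E; apply Hno; exists (x, y); auto). lra. }
    destruct (Hcont _ Hxy _ Hlt) as [d [Hd H]].
    assert (He : 0 < Rmin (d / 2) ((phi (x, y) - m) / 2)).
    { apply Rmin_pos; lra. }
    exists (mkposreal _ He). intros _ q Hq1 Hq2. simpl in *.
    pose proof (Rmin_l (d / 2) ((phi (x, y) - m) / 2)).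
    pose proof (Rmin_r (d / 2) ((phi (x, y) - m) / 2)).
    assert (Hc : Cmod (q - (x, y))%C < d).
    { eapply Rle_lt_trans; [apply Cmod_le_coords|].
      replace (fst (q - (x, y))%C) with (fst q - x) by (simpl; ring).
      replace (snd (q - (x, y))%C) with (snd q - y) by (simpl; ring). lra. }
    specialize (H q Hc). lra. }
  set (delta := fun x y => proj1_sig (constructive_indefinite_description _ (Hgap x y))).
  destruct (compactness_value_2d (fst z - r) (fst z + r) (snd z - r) (snd z + r) delta)
    as [d Hd].
  assert (Hall : forall q, in_square z r q -> m + d <= phi q).
  { intros q [Hq1 Hq2]. apply Rabs_le_between in Hq1, Hq2.
    specialize (Hd (fst q) (snd q) ltac:(lra) ltac:(lra)).
    apply NNPP in Hd. destruct Hd as [u [v [Hu [Hv [H1 [H2 H3]]]]]].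
    unfold delta in H1, H2, H3.
    destruct (constructive_indefinite_description _ (Hgap u v)) as [e He].
    simpl in H1, H2, H3.
    assert (in_square z r (u, v)).
    { split; simpl; apply Rabs_le_between; lra. }
    specialize (He H q H1 H2). lra. }
  assert (s <= - (m + d)).
  { apply Hlub. intros y [p [Hp ->]]. specialize (Hall p Hp). lra. }
  pose proof (cond_pos d). unfold m in *. lra.
Qed.

Definition open_set (D : C -> Prop) : Prop :=
  forall z, D z -> exists r, 0 < r /\ forall z', Cmod (z' - z)%C < r -> D z'.

(** On the boundary of a small square about [z] the values of [f] stay away
    from [f z], by invertibility of the differential at [z]; so for [w] near
    [f z] the minimum of [|f - w|] over the square is interior, and there it
    vanishes by [wirtinger_descent]. *)
Lemma wirtinger_open (D : C -> Prop) (f : C -> C) :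
  open_set D ->
  (forall z, D z -> exists a b, wirtinger f z a b /\ Cmod b < Cmod a) ->
  forall z r, D z -> 0 < r -> exists m, 0 < m /\
    forall w, Cmod (w - f z)%C < m ->
      exists z', D z' /\ Cmod (z' - z)%C < r /\ f z' = w.
Proof.
  intros HD Hf z r Hz Hr.
  destruct (HD z Hz) as [r0 [Hr0 HDr]].
  destruct (Hf z Hz) as [a [b [Hw Hab]]].
  destruct (wirtinger_expansion f z a b ((Cmod a - Cmod b) / 2) Hw)
    as [d [Hd Hexp]]; [lra|].
  set (kappa := (Cmod a - Cmod b) / 2) in *.
  assert (Hk : 0 < kappa) by (unfold kappa; lra).
  set (s := Rmin r (Rmin r0 d) / 3).
  assert (Hs : 0 < s).
  { unfold s. apply Rdiv_lt_0_compat; [|lra]. repeat apply Rmin_pos; assumption. }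
  assert (Hs3 : 3 * s <= r /\ 3 * s <= r0 /\ 3 * s <= d).
  { unfold s. pose proof (Rmin_l r (Rmin r0 d)). pose proof (Rmin_r r (Rmin r0 d)).
    pose proof (Rmin_l r0 d). pose proof (Rmin_r r0 d). lra. }
  assert (Hsq : forall p, in_square z s p -> Cmod (p - z)%C < 3 * s).
  { intros p [H1 H2].
    eapply Rle_lt_trans; [apply Cmod_le_coords|].
    replace (fst (p - z)%C) with (fst p - fst z) by (simpl; ring).
    replace (snd (p - z)%C) with (snd p - snd z) by (simpl; ring). lra. }
  assert (Hks : 0 < kappa * s) by (apply Rmult_lt_0_compat; assumption).
  exists (kappa * s / 2). split; [lra|].
  intros w Hwm.
  destruct (square_attains_min (fun p => Cmod (f p - w)%C) z s Hs) as [p [Hp Hmin]].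
  { intros p. apply Cmod_ge_0. }
  { intros p Hp eps Heps.
    assert (HDp : D p) by (apply HDr; specialize (Hsq p Hp); lra).
    destruct (Hf p HDp) as [a' [b' [Hw' _]]].
    pose proof (Cmod_ge_0 a'). pose proof (Cmod_ge_0 b').
    destruct (wirtinger_lipschitz f p a' b' (Cmod a' + Cmod b' + 1) Hw')
      as [d' [Hd' Hl]]; [lra|].
    set (L := Cmod a' + Cmod b' + 1) in *.
    assert (HL : 0 < L) by (unfold L; lra).
    exists (Rmin d' (eps / L)). split.
    { apply Rmin_pos; [assumption|]. apply Rdiv_lt_0_compat; assumption. }
    intros q Hq.
    pose proof (Rmin_l d' (eps / L)). pose proof (Rmin_r d' (eps / L)).
    specialize (Hl q ltac:(lra)).
    assert (L * Cmod (q - p)%C < eps).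
    { apply Rlt_le_trans with (L * (eps / L)).
      - apply Rmult_lt_compat_l; lra.
      - right. field. lra. }
    pose proof (Cmod_sum_ge (f p - w) (f q - f p)) as Ht.
    replace (f p - w + (f q - f p))%C with (f q - w)%C in Ht by ring. lra. }
  assert (Hpw : Cmod (f p - w)%C < kappa * s / 2).
  { eapply Rle_lt_trans; [apply Hmin|].
    - split; rewrite Rminus_diag, Rabs_R0; lra.
    - rewrite Cmod_sym. assumption. }
  assert (Hpz : Cmod (p - z)%C < s).
  { specialize (Hexp p ltac:(specialize (Hsq p Hp); lra)).
    pose proof (Cmod_triangle (f p - w) (w - f z)) as Ht.
    replace (f p - w + (w - f z))%C with (f p - f z)%C in Ht by ring.
    nra. }
  assert (HDp : D p) by (apply HDr; lra).
  exists p. split; [assumption|]. split; [lra|].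
  apply NNPP. intros Hne.
  destruct (Hf p HDp) as [a' [b' [Hw' Hab']]].
  destruct (wirtinger_descent f p a' b' w (s - Cmod (p - z)%C) Hw' Hab' Hne)
    as [q [Hq Hlt]]; [lra|].
  assert (Hqz : Cmod (q - z)%C < s).
  { pose proof (Cmod_triangle (q - p) (p - z)) as Ht.
    replace (q - p + (p - z))%C with (q - z)%C in Ht by ring. lra. }
  assert (Hqs : in_square z s q).
  { pose proof (fst_le_Cmod (q - z)%C) as H1. pose proof (snd_le_Cmod (q - z)%C) as H2.
    split; [change (fst q - fst z) with (fst (q - z)%C)
           |change (snd q - snd z) with (snd (q - z)%C)]; lra. }
  specialize (Hmin q Hqs). simpl in Hmin. lra.
Qed.

(** * Growth of [g] as a function of the value of [f] *)

(** A pointwise bound below [c] on the stretching of [g] composed with the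
    inverse of [f], written without naming that inverse. *)
Definition locally_slower (D : C -> Prop) (f g : C -> C) (c : R) : Prop :=
  forall z, D z -> exists c' eta, 0 <= c' < c /\ 0 < eta /\
    forall z', D z' -> Cmod (f z' - f z)%C < eta ->
      Cmod (g z' - g z)%C <= c' * Cmod (f z' - f z)%C.

(** Openness of [f] and injectivity turn closeness of the values of [f] into
    closeness of the points, where the differentials can be compared. *)
Lemma univalent_locally_slower (D : C -> Prop) (f g : C -> C) (c : R) :
  0 < c -> open_set D -> univalent_on D f ->
  (forall z, D z -> exists a b b',
     wirtinger f z a b /\ wirtinger g z b' 0 /\ Cmod b < Cmod a /\
     Cmod b' < c * (Cmod a - Cmod b)) ->
  locally_slower D f g c.
Proof.
  intros Hc HD Hinj Hw z Hz.
  destruct (Hw z Hz) as [a [b [b' [Hf [Hg [Hab Hb']]]]]].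
  set (d := c * (Cmod a - Cmod b) - Cmod b').
  assert (Hd : 0 < d) by (unfold d; lra).
  (* With the slack [d] divided in three, [(|b'| + d/3) / kappa < c]. *)
  set (kappa := Cmod a - Cmod b - d / (3 * c)).
  assert (Hdc : 0 < d / (3 * c)) by (apply Rdiv_lt_0_compat; lra).
  assert (Hck : c * kappa = Cmod b' + 2 * d / 3).
  { unfold kappa, d. field. lra. }
  pose proof (Cmod_ge_0 b') as Hb0.
  assert (Hk : 0 < kappa) by nra.
  destruct (wirtinger_expansion f z a b kappa Hf) as [d1 [Hd1 H1]].
  { unfold kappa. lra. }
  destruct (wirtinger_lipschitz g z b' 0 (Cmod b' + d / 3) Hg) as [d2 [Hd2 H2]].
  { rewrite Cmod_0. lra. }
  destruct (wirtinger_open D f HD) with (z := z) (r := Rmin d1 d2)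
    as [m [Hm Hopen]]; auto.
  { intros y Hy. destruct (Hw y Hy) as [a0 [b0 [b0' H0]]]. exists a0, b0. tauto. }
  { apply Rmin_pos; assumption. }
  exists ((Cmod b' + d / 3) / kappa), m. split; [split|split; [assumption|]].
  - apply Rlt_le, Rdiv_lt_0_compat; lra.
  - apply Rmult_lt_reg_r with kappa; [assumption|].
    rewrite Hck. replace ((Cmod b' + d / 3) / kappa * kappa) with (Cmod b' + d / 3)
      by (field; lra). lra.
  - intros z' Hz' Hlt.
    destruct (Hopen (f z') Hlt) as [z'' [HDz'' [Hzz E]]].
    apply Hinj in E; [subst z''|assumption|assumption].
    pose proof (Rmin_l d1 d2). pose proof (Rmin_r d1 d2).
    specialize (H1 z' ltac:(lra)). specialize (H2 z' ltac:(lra)).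
    eapply Rle_trans; [exact H2|].
    replace ((Cmod b' + d / 3) / kappa * Cmod (f z' - f z)%C)
      with ((Cmod b' + d / 3) * (Cmod (f z' - f z)%C / kappa)) by (field; lra).
    apply Rmult_le_compat_l; [lra|].
    apply Rmult_le_reg_r with kappa; [assumption|].
    replace (Cmod (f z' - f z)%C / kappa * kappa) with (Cmod (f z' - f z)%C)
      by (field; lra). lra.
Qed.

Lemma continuous_on_eps (gamma : R -> C) (t : R) :
  continuous_on unit_interval gamma -> unit_interval t ->
  forall eps, 0 < eps -> exists delta, 0 < delta /\
    forall s, unit_interval s -> Rabs (s - t) < delta ->
      Cmod (gamma s - gamma t)%C < eps.
Proof.
  intros Hc Ht eps Heps.
  assert (He : 0 < eps / 2) by lra.
  destruct (Hc t Ht (ball (gamma t) (mkposreal _ He))) as [d Hd].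
  { apply locally_ball. }
  exists d. split; [apply cond_pos|]. intros s Hs Hst.
  destruct (Hd s Hst Hs) as [H1 H2].
  change (Rabs (fst (gamma s) - fst (gamma t)) < eps / 2) in H1.
  change (Rabs (snd (gamma s) - snd (gamma t)) < eps / 2) in H2.
  eapply Rle_lt_trans; [apply Cmod_le_coords|].
  change (fst (gamma s - gamma t)%C) with (fst (gamma s) - fst (gamma t)).
  change (snd (gamma s - gamma t)%C) with (snd (gamma s) - snd (gamma t)).
  lra.
Qed.

(** [inscribed_length] for the part of [gamma] up to the parameter [x]. *)
Definition inscribed_to (gamma : R -> C) (x l : R) : Prop :=
  exists (n : nat) (t : nat -> R),
    t 0%nat = 0 /\ t (S n) = x /\
    (forall k : nat, (k <= n)%nat -> t k <= t (S k)) /\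
    l = sum_f_R0 (fun k => Cmod (gamma (t (S k)) - gamma (t k))%C) n.

Lemma inscribed_to_extend (gamma : R -> C) (x y l : R) :
  x <= y -> inscribed_to gamma x l ->
  inscribed_to gamma y (l + Cmod (gamma y - gamma x)%C).
Proof.
  intros Hxy [n [t [H0 [Hx [Hmono ->]]]]].
  exists (S n), (fun k => if Compare_dec.le_dec k (S n) then t k else y).
  repeat split.
  - destruct (Compare_dec.le_dec 0 (S n)); [assumption|lia].
  - destruct (Compare_dec.le_dec (S (S n)) (S n)); [lia|reflexivity].
  - intros k Hk. destruct (Compare_dec.le_dec k (S n)); [|lia].
    destruct (Compare_dec.le_dec (S k) (S n)).
    + apply Hmono. lia.
    + replace k with (S n) by lia. lra.
  - rewrite tech5. f_equal.
    + apply sum_eq. intros k Hk.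
      destruct (Compare_dec.le_dec (S k) (S n)); [|lia].
      destruct (Compare_dec.le_dec k (S n)); [reflexivity|lia].
    + destruct (Compare_dec.le_dec (S (S n)) (S n)); [lia|].
      destruct (Compare_dec.le_dec (S n) (S n)); [|lia]. rewrite Hx. reflexivity.
Qed.

Lemma inscribed_to_ge_0 (gamma : R -> C) (x l : R) :
  inscribed_to gamma x l -> 0 <= l.
Proof.
  intros [n [t [_ [_ [_ ->]]]]]. apply cond_pos_sum. intros. apply Cmod_ge_0.
Qed.

(** Continuous induction on the parameter of the path: the set of parameters up
    to which the bound holds, with some constant below [c] and some inscribed
    polygon, contains its supremum and can be prolonged beyond it. *)
Lemma path_growth (D : C -> Prop) (f g : C -> C) (c : R) (gamma : R -> C)
    (z1 z2 : C) :
  locally_slower D f g c -> D z1 -> D z2 ->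
  path_in (image f D) (f z1) (f z2) gamma ->
  exists c' l, 0 <= c' < c /\ inscribed_length gamma l /\
    Cmod (g z2 - g z1)%C <= c' * l.
Proof.
  intros Hloc Hz1 Hz2 [Hcont [Hg0 [Hg1 Him]]].
  set (reach := fun x => exists c' l, 0 <= c' < c /\ inscribed_to gamma x l /\
    forall z, D z -> f z = gamma x -> Cmod (g z - g z1)%C <= c' * l).
  (* Prolongation by one segment on which the bound holds with constant [c2] *)
  assert (Hstep : forall x y c2, unit_interval x -> x <= y -> 0 <= c2 < c ->
    (forall zx zy, D zx -> D zy -> f zx = gamma x -> f zy = gamma y ->
      Cmod (g zy - g zx)%C <= c2 * Cmod (gamma y - gamma x)%C) ->
    reach x -> reach y).
  { intros x y c2 Hx Hxy Hc2 Hlink [c1 [l [Hc1 [Hl Hb]]]].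
    exists (Rmax c1 c2), (l + Cmod (gamma y - gamma x)%C).
    pose proof (Rmax_l c1 c2). pose proof (Rmax_r c1 c2).
    split; [split; [lra|apply Rmax_lub_lt; lra]|].
    split; [apply inscribed_to_extend; assumption|].
    intros zy Hzy Ey.
    destruct (Him x Hx) as [zx [Hzx Ex]].
    specialize (Hb zx Hzx Ex). specialize (Hlink zx zy Hzx Hzy Ex Ey).
    pose proof (Cmod_triangle (g zy - g zx) (g zx - g z1)) as Ht.
    replace (g zy - g zx + (g zx - g z1))%C with (g zy - g z1)%C in Ht by ring.
    pose proof (inscribed_to_ge_0 _ _ _ Hl).
    pose proof (Cmod_ge_0 (gamma y - gamma x)%C). nra. }
  assert (Hnear : forall s, unit_interval s -> exists c2 delta, 0 <= c2 < c /\ 0 < delta /\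
    forall y zs zy, unit_interval y -> Rabs (y - s) < delta -> D zs -> D zy ->
      f zs = gamma s -> f zy = gamma y ->
      Cmod (g zy - g zs)%C <= c2 * Cmod (gamma y - gamma s)%C).
  { intros s Hs. destruct (Him s Hs) as [z0 [Hz0 E0]].
    destruct (Hloc z0 Hz0) as [c2 [eta [Hc2 [Heta H]]]].
    destruct (continuous_on_eps gamma s Hcont Hs eta Heta) as [d [Hd Hds]].
    exists c2, d. split; [assumption|]. split; [assumption|].
    intros y zs zy Hy Hys Hzs Hzy Es Ey.
    specialize (Hds y Hy Hys).
    (* [zs] and [z0] have the same value under [f], hence under [g]. *)
    assert (Hzz : Cmod (f zs - f z0)%C = 0).
    { rewrite Es, E0. replace (gamma s - gamma s)%C with (RtoC 0) by ring. apply Cmod_0. }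
    assert (Hgg := H zs Hzs ltac:(lra)). rewrite Hzz, Rmult_0_r in Hgg.
    specialize (H zy Hzy). rewrite Ey, E0 in H. specialize (H Hds).
    pose proof (Cmod_triangle (g zy - g z0) (g z0 - g zs)) as Ht.
    rewrite (Cmod_sym (g z0) (g zs)) in Ht.
    replace (g zy - g z0 + (g z0 - g zs))%C with (g zy - g zs)%C in Ht by ring.
    lra. }
  assert (HI0 : unit_interval 0) by (unfold unit_interval; lra).
  assert (Hreach0 : reach 0).
  { destruct (Hnear 0 HI0) as [c2 [d [Hc2 [Hd H]]]].
    assert (Hz : Cmod (gamma 0 - gamma 0)%C = 0).
    { replace (gamma 0 - gamma 0)%C with (RtoC 0) by ring. apply Cmod_0. }
    exists c2, 0. split; [assumption|]. split.
    - exists 0%nat, (fun _ => 0). repeat split; intros; try lra.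
      simpl. symmetry. exact Hz.
    - intros z Hz' E. rewrite <- Hz.
      apply H; auto. rewrite Rminus_diag, Rabs_R0. assumption. }
  destruct (completeness (fun x => unit_interval x /\ reach x)) as [s [Hub Hlub]].
  { exists 1. intros x [[_ Hx] _]. assumption. }
  { exists 0. auto. }
  assert (Hs : unit_interval s).
  { split; [apply Hub; auto|]. apply Hlub. intros x [[_ Hx] _]. assumption. }
  destruct (Hnear s Hs) as [c2 [d [Hc2 [Hd Hlink]]]].
  assert (Hrs : reach s).
  { destruct (classic (exists x, unit_interval x /\ reach x /\ s - d < x))
      as [[x [Hx [Hrx Hxs]]]|Hno].
    - assert (x <= s) by (apply Hub; auto).
      apply (Hstep x s c2); auto.
      intros zx zs Hzx Hzs Ex Es.
      rewrite Cmod_sym, (Cmod_sym (gamma s)).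
      apply Hlink; auto. apply Rabs_lt_between. lra.
    - exfalso. assert (s <= s - d); [|lra].
      apply Hlub. intros x [Hx Hrx]. apply Rnot_lt_le. intros Hlt.
      apply Hno. exists x. auto. }
  assert (Hs1 : s = 1).
  { destruct Hs as [Hs0 Hs1]. apply NNPP. intros Hne.
    set (y := Rmin 1 (s + d / 2)).
    assert (Hy : s < y <= s + d / 2).
    { split; [apply Rmin_glb_lt; lra|apply Rmin_r]. }
    assert (HyI : unit_interval y).
    { split; [lra|apply Rmin_l]. }
    assert (y <= s); [|lra].
    apply Hub. split; [assumption|].
    apply (Hstep s y c2); [split; assumption|lra|assumption| |assumption].
    intros zs zy Hzs Hzy Es Ey. apply Hlink; auto. apply Rabs_lt_between. lra. }
  subst s. destruct Hrs as [c' [l [Hc' [Hl Hb]]]].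
  exists c', l. split; [assumption|]. split; [exact Hl|].
  apply Hb; auto.
Qed.

(** * Univalence of the rotated mappings *)

Lemma inscribed_length_le (gamma : R -> C) (l L : R) :
  Rbar_le (path_length gamma) (Finite L) -> inscribed_length gamma l -> l <= L.
Proof.
  intros HL Hl.
  destruct (Lub_Rbar_correct (inscribed_length gamma)) as [Hub _].
  exact (Rbar_le_trans (Finite l) _ (Finite L) (Hub l Hl) HL).
Qed.

Lemma chord_inscribed (gamma : R -> C) :
  inscribed_length gamma (Cmod (gamma 1 - gamma 0)%C).
Proof.
  exists 0%nat, INR. repeat split.
  intros k _. apply le_INR. lia.
Qed.

Lemma unit_disk_open : open_set unit_disk.
Proof.
  intros z Hz. unfold unit_disk in *. exists (1 - Cmod z). split; [lra|].
  intros z' Hz'. pose proof (Cmod_triangle (z' - z) z) as Ht.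
  replace (z' - z + z)%C with z' in Ht by ring. lra.
Qed.

Lemma Cmod_cis (theta : R) : Cmod (cis theta) = 1.
Proof.
  unfold Cmod, cis; simpl.
  replace (_ + _) with (Rsqr (sin theta) + Rsqr (cos theta)) by (unfold Rsqr; ring).
  rewrite sin2_cos2. apply sqrt_1.
Qed.

Theorem theorem3 :
  forall (f h g : C -> C) (M : R),
    holomorphic_on unit_disk h ->
    holomorphic_on unit_disk g ->
    (forall z : C, unit_disk z -> f z = (h z + Cconj (g z))%C) ->
    sense_preserving_on unit_disk f ->
    univalent_on unit_disk f ->
    linearly_connected (image f unit_disk) M ->
    (forall z : C, unit_disk z -> Cmod (dilatation h g z) < 1 / (1 + 2 * M)) ->
    forall theta : R,
      univalent_on unit_disk (fun z => (h z + cis theta * Cconj (g z))%C).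
Proof.
  intros f h g M Hh Hg Hf Hsp Hinj Hlin Hdil theta z1 z2 Hz1 Hz2 HF.
  apply NNPP. intros Hne.
  assert (Hw : 0 < Cmod (f z1 - f z2)%C).
  { apply Cmod_gt_0. intros E. apply Hne. apply Hinj; auto.
    replace (f z1) with (f z1 - f z2 + f z2)%C by ring. rewrite E. ring. }
  destruct (Hlin (f z1) (f z2)) as [gamma [Hpath Hlen]];
    [exists z1; auto|exists z2; auto|].
  (* The path is at least as long as its chord. *)
  assert (HM : 1 <= M).
  { assert (H := inscribed_length_le _ _ _ Hlen (chord_inscribed gamma)).
    destruct Hpath as [_ [E0 [E1 _]]]. rewrite E0, E1, Cmod_sym in H.
    nra. }
  assert (Hc : 0 < 1 / (2 * M)) by (apply Rdiv_lt_0_compat; lra).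
  assert (Hslow : locally_slower unit_disk f g (1 / (2 * M))).
  { apply univalent_locally_slower; auto using unit_disk_open.
    intros z Hz.
    assert (Wh := is_derive_wirtinger h z _ (C_derive_correct h z 0 (Hh z Hz))).
    assert (Wg := is_derive_wirtinger g z _ (C_derive_correct g z 0 (Hg z Hz))).
    destruct (unit_disk_open z Hz) as [r [Hr HDr]].
    assert (Wf := wirtinger_add_conj f h g z _ _ r Hr
                    (fun z' H => Hf z' (HDr z' H)) Wh Wg).
    specialize (Hdil z Hz). specialize (Hsp z Hz). unfold dilatation in Hdil.
    rewrite (wirtinger_jacobian _ _ _ _ Wf), Cmod_conj in Hsp.
    set (a := C_derive h z) in *. set (b := C_derive g z) in *.
    pose proof (Cmod_ge_0 a). pose proof (Cmod_ge_0 b).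
    assert (Hab : Cmod b < Cmod a) by nra.
    assert (Ha : a <> 0) by (apply Cmod_gt_0; lra).
    exists a, (Cconj b), b. rewrite Cmod_conj.
    split; [exact Wf|]. split; [exact Wg|]. split; [assumption|].
    rewrite Cmod_div in Hdil by assumption.
    assert (Hba : Cmod b * (1 + 2 * M) < Cmod a).
    { apply Rmult_lt_compat_r with (r := Cmod a * (1 + 2 * M)) in Hdil; [|nra].
      replace (Cmod b / Cmod a * (Cmod a * (1 + 2 * M)))
        with (Cmod b * (1 + 2 * M)) in Hdil by (field; lra).
      replace (1 / (1 + 2 * M) * (Cmod a * (1 + 2 * M)))
        with (Cmod a) in Hdil by (field; lra).
      assumption. }
    apply Rmult_lt_reg_l with (2 * M); [lra|].
    replace (2 * M * (1 / (2 * M) * (Cmod a - Cmod b)))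
      with (Cmod a - Cmod b) by (field; lra).
    lra. }
  destruct (path_growth _ _ _ _ _ _ _ Hslow Hz1 Hz2 Hpath)
    as [c' [l [Hc' [Hl Hgl]]]].
  assert (HlM := inscribed_length_le _ _ _ Hlen Hl).
  set (W := Cmod (f z1 - f z2)%C) in *.
  assert (Hsmall : 2 * Cmod (g z2 - g z1)%C < W).
  { assert (c' * l <= c' * (M * W)) by (apply Rmult_le_compat_l; lra).
    assert (c' * (M * W) < 1 / (2 * M) * (M * W)).
    { apply Rmult_lt_compat_r; [|lra]. apply Rmult_lt_0_compat; lra. }
    replace (1 / (2 * M) * (M * W)) with (W / 2) in * by (field; lra). lra. }
  assert (HW : W <= 2 * Cmod (g z2 - g z1)%C).
  { assert (E : (f z1 - f z2)%C = ((1 + - cis theta) * Cconj (g z1 - g z2))%C).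
    { rewrite (Hf z1 Hz1), (Hf z2 Hz2), Cminus_conj.
      replace (h z1) with (h z2 + cis theta * Cconj (g z2) - cis theta * Cconj (g z1))%C
        by (rewrite <- HF; ring).
      ring. }
    unfold W. rewrite E, Cmod_mult, Cmod_conj, (Cmod_sym (g z1)).
    apply Rmult_le_compat_r; [apply Cmod_ge_0|].
    eapply Rle_trans; [apply Cmod_triangle|].
    rewrite Cmod_opp, Cmod_1, Cmod_cis. lra. }
  lra.
Qed.
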